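(* Let $A\subset\mathbb{Z}^2$ be a simply connected set containing the origin, and let $x^1,x^2,y^2,y^1$ be four distinct points ordered counterclockwise around $\partial A$. Let $S^1$ and $S^2$ be independent, where $S^1$ is a simple random walk excursion in $A$ from $x^1$ to $y^1$ and $S^2$ is a simple random walk excursion in $A$ from $x^2$ to $y^2$; let $\mathcal{L}^1:=\mathcal{L}(S^1)$ be the loop erasure of $S^1$ (the path of a loop-erased random walk excursion from $x^1$ to $y^1$). Regarding paths as the sets of vertices they visit, $$\mathbf{P}\{\mathcal{L}^1\cap S^2=\emptyset\}=\frac{\det\begin{bmatrix}h_{\partial A}(x^1,y^1)&h_{\partial A}(x^1,y^2)\\ h_{\partial A}(x^2,y^1)&h_{\partial A}(x^2,y^2)\end{bmatrix}}{h_{\partial A}(x^1,y^1)\,h_{\partial A}(x^2,y^2)}.$$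
   Context: $\mathbb{Z}^2$ carries its nearest-neighbour graph structure. The (outer) boundary of $A\subset\mathbb{Z}^2$ is $\partial A:=\{z\in\mathbb{Z}^2\setminus A:\operatorname{dist}(z,A)=1\}$. $A$ is simply connected if both $A$ and $\mathbb{Z}^2\setminus A$ are non-empty and connected. A discrete excursion in $A$ is a path $\omega=[\omega_0,\ldots,\omega_k]$ with $2\le k<\infty$, $\omega_0,\omega_k\in\partial A$, $\omega_1,\ldots,\omega_{k-1}\in A$, and $|\omega_j-\omega_{j-1}|=1$ for $j=1,\ldots,k$; its length is $|\omega|=k$, and $p(\omega):=4^{-|\omega|}$ is the probability that simple random walk started at $\omega_0$ follows $\omega$ for its first $k$ steps. For $x,y\in\partial A$, $\mathcal{K}_A(x,y)$ is the set of discrete excursions in $A$ from $x$ to $y$. The discrete excursion Poisson kernel is $$h_{\partial A}(x,y):=\mathbf{P}^x\{S_{\tau_A}=y,\ S_1\in A\}=\sum_{\omega\in\mathcal{K}_A(x,y)}p(\omega),$$ where $S_j$, $j=0,1,\ldots$, is simple random walk on $\mathbb{Z}^2$, $\mathbf{P}^x$ is its law when started at $x$, and $\tau_A=\inf\{j\ge1:S_j\notin A\}$. A simple random walk excursion in $A$ from $x$ to $y$ is a random element of $\mathcal{K}_A(x,y)$ equal to $\omega$ with probability $p(\omega)/h_{\partial A}(x,y)$ (i.e. simple random walk from $x$ conditioned to step into $A$ and then leave $A$ at $y$). Loop erasure: for a finite path $S=[S_0,\ldots,S_k]$, set $\mathcal{L}(S):=S$ if $S$ is self-avoiding. Otherwise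 let $s_0:=\max\{j:S_j=S_0\}$ and, for $i>0$, $s_i:=\max\{j:S_j=S_{s_{i-1}+1}\}$; with $m:=\min\{i:s_i=k\}$, $\mathcal{L}(S):=[S_{s_0},S_{s_1},\ldots,S_{s_m}]$. *)

(* Defs.v *)
From HB Require Import structures.
From mathcomp Require Import all_boot all_order all_algebra.
From mathcomp Require Import all_classical all_reals all_analysis.

Set Implicit Arguments.
Unset Strict Implicit.
Unset Printing Implicit Defensive.

Import Order.TTheory GRing.Theory Num.Theory.

Local Open Scope classical_set_scope.
Local Open Scope ring_scope.

Notation site := (int * int)%type.

Definition adj (u v : site) : bool := `|u.1 - v.1| + `|u.2 - v.2| == 1.

Definition boundary (A : set site) : set site :=
  [set z | ~ A z /\ exists2 a, A a & adj z a].

Definition graph_connected (A : set site) : Prop :=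
  forall u v, A u -> A v ->
  exists s : seq site,
    [/\ path adj u s, last u s = v & forall w, w \in s -> A w].

Definition simply_connected (A : set site) : Prop :=
  [/\ A !=set0, (~` A) !=set0, graph_connected A & graph_connected (~` A)].

(* The boundary of A, seen as the boundary of the union of the unit squares
   centred at the points of A, is made of the sides separating some a in A from
   some neighbour z not in A; such a side is encoded by the pair (a, z). *)
Definition boundary_side (A : set site) (e : site * site) : Prop :=
  [/\ A e.1, ~ A e.2 & adj e.1 e.2].

(* Rotation by +90 degrees. *)
Definition rot90 (v : site) : site := (- v.2, v.1).

(* The side following (a, z) when the boundary is travelled with A on the left,
   that is, counterclockwise. The side (a, z) is travelled in the direction t,
   and the next side is chosen by looking at the squares a + t and z + t. *)
Definition next_side (A : set site) (e : site * site) : site * site :=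
  let: (a, z) := e in
  let t := rot90 (z - a) in
  if a + t \notin A then (a, a + t)
  else if z + t \notin A then (a + t, z + t)
  else (z + t, z).

(* Cyclic order: some stretch of the boundary meets the four sides in this order
   up to rotation. The rotation matters when A is infinite and its boundary is a
   bi-infinite line, which is then regarded as closed up at infinity. *)
Definition ccw_sides (A : set site) (e1 e2 e3 e4 : site * site) : Prop :=
  exists (s : seq (site * site)) (n : nat),
    [/\ sorted (frel (next_side A)) s, uniq s
      & subseq (rot n [:: e1; e2; e3; e4]) s].

(* A boundary point may be met several times along the boundary (think of a slit
   domain, each inner point of the slit being reachable from both sides). Points
   of the boundary are in counterclockwise order when they are so from whichever
   side they are looked at. Asking it of some sides only would let the four
   successive points p1, p2, p3, p4 of a slit be at the same time in the order
   p1, p2, p3, p4 and in the order p1, p3, p4, p2. *)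
Definition ccw (A : set site) (z1 z2 z3 z4 : site) : Prop :=
  forall a1 a2 a3 a4 : site,
    boundary_side A (a1, z1) -> boundary_side A (a2, z2) ->
    boundary_side A (a3, z3) -> boundary_side A (a4, z4) ->
    ccw_sides A (a1, z1) (a2, z2) (a3, z3) (a4, z4).

(* The path [w_0, ..., w_k] is the sequence of its k + 1 sites; s holds
   w_1, ..., w_(k-1), so that s <> [::] means 2 <= k. *)
Definition excursions (A : set site) (x y : site) : set (seq site) :=
  [set w | [/\ boundary A x, boundary A y & exists s : seq site,
    [/\ w = x :: rcons s y, s <> [::], (forall v, v \in s -> A v)
      & sorted adj w]]].

Definition walk_weight (R : realType) (w : seq site) : R :=
  4%:R ^- (size w).-1.

(* The sum is a probability, so that fine loses nothing. *)
Definition excursion_kernel (R : realType) (A : set site) (x y : site) : R :=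
  fine (\esum_(w in excursions A x y) (walk_weight R w)%:E)%E.

Definition rw_excursion d (T : measurableType d) (R : realType)
    (P : probability T R) (A : set site) (x y : site) (S : T -> seq site) :
    Prop :=
  [/\ forall t, excursions A x y (S t),
      forall w, measurable (S @^-1` [set w])
    & forall w, excursions A x y w ->
        P (S @^-1` [set w]) = (walk_weight R w / excursion_kernel R A x y)%:E].

(* All sets of paths may be used here: there are countably many paths, so that
   every event on a random path is measurable as soon as its level sets are. *)
Definition independent_paths d (T : measurableType d) (R : realType)
    (P : probability T R) (S1 S2 : T -> seq site) : Prop :=
  forall U V : set (seq site),
    P ((S1 @^-1` U) `&` (S2 @^-1` V))
      = (P (S1 @^-1` U) * P (S2 @^-1` V))%E.

Definition last_visit (S : seq site) (v : site) : nat :=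
  \max_(j < size S | nth (0, 0) S j == v) j.

Fixpoint loop_erasure_time (S : seq site) (i : nat) : nat :=
  last_visit S
    (nth (0, 0) S (if i is i'.+1 then (loop_erasure_time S i').+1 else 0%N)).

(* m is the least i with loop_erasure_time S i = k, where k = (size S).-1; as
   these times increase strictly until k is reached, m <= k. *)
Definition loop_erasure (S : seq site) : seq site :=
  if uniq S then S else
  let m := find (fun i => loop_erasure_time S i == (size S).-1)
                (iota 0 (size S)) in
  [seq nth (0, 0) S (loop_erasure_time S i) | i <- iota 0 m.+1].

(* Main.v *)
Require Import Defs.
From HB Require Import structures.
From mathcomp Require Import all_boot all_order all_algebra.
From mathcomp Require Import all_classical all_reals all_analysis.
From mathcomp Require Import zify ring.

Set Implicit Arguments.
Unset Strict Implicit.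
Unset Printing Implicit Defensive.

Import Order.TTheory GRing.Theory Num.Theory.

Local Open Scope classical_set_scope.
Local Open Scope ring_scope.

(* Fomin's identity for two walks. Take excursions w1 from x1 to y1 and w2 from
   x2 to y2 such that the loop erasure of w1 meets w2, let v be the first vertex
   of this loop erasure lying on w2, and exchange the tails of w1 and w2 after
   their last visits of v. This is a weight-preserving involution onto the pairs
   of excursions from x1 to y2 and from x2 to y1 satisfying the same condition,
   and for these endpoints the condition always holds by planarity. Hence the
   pairs that meet have total weight h(x1, y2) h(x2, y1), to be subtracted from
   h(x1, y1) h(x2, y2).

   Planarity: if X, Y are disjoint connected subsets of A with X touching the
   sides f1, f3 and Y the sides f2, f4, close up a path of X from f1 to f3 by a
   path in the complement of A. The winding parity of this closed walk C is
   constant along Y, since C avoids Y. But along the boundary from f2 to f4 it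
   changes exactly once, at f3, as C crosses the boundary at f1 and f3 only. *)

(** * Loop erasure *)

(* [p] is the part of the walk before the last visit of its starting point
   [x]. *)
Inductive erases (T : eqType) : seq T -> seq T -> Prop :=
| erases_nil : erases [::] [::]
| erases_cons p x u l : head x p = x -> x \notin u -> erases u l ->
    erases (p ++ x :: u) (x :: l).

Lemma last_occurrence_inj (T : eqType) (v : T) (a b c d : seq T) :
  v \notin b -> v \notin d -> a ++ v :: b = c ++ v :: d -> a = c /\ b = d.
Proof.
move=> vb vd; elim: a c => [|x a IH] [|y c] //= [].
- by move=> ->.
- by move=> _ bE; move: vb; rewrite bE mem_cat mem_head orbT.
- by move=> _ aE; move: vd; rewrite -aE mem_cat mem_head orbT.
- by move=> -> /IH[-> ->].
Qed.

(** Lets a loop erasure be identified from any derivation of [erases], without visit times. *)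
Lemma erases_fun (T : eqType) (w l l' : seq T) :
  erases w l -> erases w l' -> l = l'.
Proof.
move=> wl; elim: wl l' => [|p x u l1 px xu _ IH] l' wl'.
  by inversion wl' as [|p x u l1 px xu ul E E'] => //; case: (p) E.
inversion wl' as [E E'|p' x' u' l2 px' xu' ul2 E E'].
  by case: (p) E.
have xx : x' = x.
  move: px px' (congr1 (head x) E).
  by case: (p) => [|? ?]; case: (p') => [|? ?] /= *; congruence.
move: px' xu' ul2 E; rewrite {}xx => px' xu' ul2 /last_occurrence_inj.
by move=> /(_ xu' xu)[_ uE]; rewrite uE in ul2; rewrite (IH _ ul2).
Qed.

Lemma erases_sub (T : eqType) (w l : seq T) :
  erases w l -> {subset l <= w}.
Proof.
elim=> // p x u l' _ _ _ IH y; rewrite in_cons mem_cat in_cons orbCA.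
by move=> /predU1P[->|/IH ->]; rewrite ?eqxx ?orbT.
Qed.

(** As no vertex of [l] recurs in [b], the last visits used to erase [w] remain last visits in
    [w ++ b]. *)
Lemma erases_cat (T : eqType) (w l b m : seq T) :
  erases w l -> {in l, forall x, x \notin b} -> erases b m ->
  erases (w ++ b) (l ++ m).
Proof.
move=> wl; elim: wl => [|p x u l' px xu ul IH] //= lb bm.
rewrite -catA /=; apply: erases_cons => //.
  by rewrite mem_cat negb_or xu lb ?mem_head.
by apply: IH => // y yl; rewrite lb // in_cons yl orbT.
Qed.

(** A vertex enters the erasure at its last visit, so cutting [w] there leaves a tail that avoids
    [v] and every vertex retained before it. *)
Lemma erases_split (T : eqType) (w l1 l2 : seq T) (v : T) :
  erases w (l1 ++ v :: l2) -> exists a b,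
  [/\ w = a ++ v :: b, erases (rcons a v) (rcons l1 v), v \notin b,
      {in l1, forall x, x \notin b} & erases b l2].
Proof.
elim: l1 w => [|x l1 IH] w wl; inversion wl as [|p x' u l' px xu ul E [E1 E2]].
  exists p, u; subst; split => //; rewrite -cats1; apply: erases_cons => //.
  exact: erases_nil.
subst; have [a [b [uE ea vb l1b bl2]]] := IH _ ul.
move: xu; rewrite uE => xu.
exists (p ++ x :: a), b; split => //; first by rewrite -catA.
- rewrite rcons_cat /=; apply: erases_cons => //.
  by apply: contra xu; rewrite -cats1 !mem_cat !in_cons orbF orbA => ->.
- move=> y; rewrite in_cons => /predU1P[->|/l1b //].
  by apply: contra xu; rewrite mem_cat in_cons => ->; rewrite !orbT.
Qed.

Lemma last_visit_ge (S : seq site) (v : site) (j : nat) :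
  (j < size S)%N -> nth (0, 0) S j = v -> (j <= last_visit S v)%N.
Proof.
move=> jS <-; rewrite /last_visit.
exact: (@leq_bigmax_cond _
  (fun i : 'I_(size S) => nth (0, 0) S i == nth (0, 0) S j)
  (fun i => i) (Ordinal jS)).
Qed.

Lemma last_visitP (S : seq site) (v : site) : v \in S ->
  (last_visit S v < size S)%N /\ nth (0, 0) S (last_visit S v) = v.
Proof.
move=> vS; have jS : (index v S < size S)%N by rewrite index_mem.
rewrite /last_visit.
have [|i /eqP iv ->] := @eq_bigmax_cond _
    (fun i : 'I_(size S) => nth (0, 0) S i == v) (fun i => i).
  by apply/card_gt0P; exists (Ordinal jS); rewrite unfold_in /= nth_index.
by rewrite iv.
Qed.

(** Stage [i] of the erasure starts at [k], one step after the previous last visit. The induction is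
    on [n], a bound on the length that remains, which ensures that [find] succeeds within
    [iota i n]. *)
Lemma erases_loop_erasure_time (S : seq site) (n i : nat) :
  let k := if i is i'.+1 then (loop_erasure_time S i').+1 else 0%N in
  (k < size S)%N -> (size S - k <= n)%N ->
  let m := find (fun j => loop_erasure_time S j == (size S).-1) (iota i n) in
  erases (drop k S)
         [seq nth (0, 0) S (loop_erasure_time S j) | j <- iota i m.+1].
Proof.
elim: n i => [|n IH] i k kS.
  by rewrite leqn0 subn_eq0 leqNgt kS.
move=> kn m.
set t := loop_erasure_time S i.
have tE : t = last_visit S (nth (0, 0) S k) by rewrite /t /k; case: (i).
have vS : nth (0, 0) S k \in S by rewrite mem_nth.
have [tS nt] := last_visitP vS; rewrite -!tE in tS nt.
have kt : (k <= t)%N by rewrite tE; apply: last_visit_ge.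
have dE : drop k S = take (t - k) (drop k S) ++ nth (0, 0) S t :: drop t.+1 S.
  rewrite -(drop_nth _ tS) -{1}(cat_take_drop (t - k) (drop k S)).
  by rewrite drop_drop subnK.
have hd : head (nth (0, 0) S t) (take (t - k) (drop k S)) = nth (0, 0) S t.
  rewrite nt (drop_nth (0, 0) kS); case: (t - k)%N => //=.
have nin : nth (0, 0) S t \notin drop t.+1 S.
  apply/negP => /(nthP (0, 0))[j]; rewrite size_drop nth_drop nt => jS jE.
  have := @last_visit_ge S (nth (0, 0) S k) (t.+1 + j)%N _ jE.
  rewrite -tE -ltn_subRL => /(_ jS).
  by rewrite addSn ltnNge leq_addr.
rewrite dE [iota _ _]/= [map _ _]/=; apply: erases_cons => //.
(* Either this last visit ends the walk, so that [find] stops and nothing remains, or stage [i.+1]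
   starts at [t.+1]. *)
rewrite {}/m [iota i n.+1]/= [find _ _]/= -/t; case: eqP => [tlast|tnlast].
  rewrite /= drop_oversize; first exact: erases_nil.
  by rewrite tlast prednK // (leq_ltn_trans _ tS).
apply: (IH i.+1).
  have : (t <= (size S).-1)%N by rewrite -ltnS prednK // (leq_ltn_trans _ tS).
  by rewrite leq_eqVlt => /predU1P[//|]; rewrite ltn_predRL.
rewrite leq_subLR; apply: (@leq_trans (k + n.+1)%N).
  by rewrite -leq_subLR.
by rewrite addnS addSn ltnS leq_add2r.
Qed.

Lemma erases_uniq (T : eqType) (w : seq T) : uniq w -> erases w w.
Proof.
elim: w => [|x w IH] /= => [_|/andP[xw uw]]; first exact: erases_nil.
by apply: (@erases_cons _ [::]) => //; exact: IH.
Qed.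

Lemma erases_loop_erasure (S : seq site) : erases S (loop_erasure S).
Proof.
rewrite /loop_erasure; case: ifP => [/erases_uniq //|nu].
have S0 : (0 < size S)%N by case: (S) nu.
have /(_ (size S)) := @erases_loop_erasure_time S _ 0%N S0.
by rewrite drop0; apply; rewrite subn0.
Qed.

Lemma erases_uniq_out (T : eqType) (w l : seq T) : erases w l -> uniq l.
Proof.
elim=> //= p x u l' _ xu ul ->; rewrite andbT.
by apply: contra xu => /(erases_sub ul).
Qed.

Lemma erases_head (T : eqType) (z : T) (w l : seq T) :
  erases w l -> head z l = head z w.
Proof. by case=> // -[|y p] x u l' //= ->. Qed.

(** The erasure steps from [z] to the last visit of [x], the walk to its first one; the site is the
    same, so the step is still allowed. *)
Lemma erases_path (T : eqType) (e : rel T) (z : T) (w l : seq T) :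
  erases w l -> path e z w -> path e z l /\ last z l = last z w.
Proof.
move=> wl; elim: wl z => // p x u l' px _ _ IH z.
rewrite last_cat cat_path /= => /and3P[zp px' /IH[-> ->]]; split => //.
by case: (p) px zp px' => /= [_ _ ->|y p' -> /andP[->]].
Qed.

Lemma erases_cons_inv (T : eqType) (x : T) (u l : seq T) :
  x \notin u -> erases (x :: u) l -> exists2 l', l = x :: l' & erases u l'.
Proof.
move=> xu wl; inversion wl as [|p x' u' l2 px' xu' ul2 E E'].
  have xx : x' = x.
    by move: px' (congr1 (head x) E); case: (p) => [|? ?] /= *; congruence.
rewrite {}xx in px' xu' E *.
have [_ <-] := @last_occurrence_inj _ x p u' [::] u xu' xu E.
by exists l2.
Qed.

(** * Planarity *)

Ltac decide_atoms :=
  repeat (match goal with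
  | |- context [?x == ?y] =>
      first [ rewrite (_ : (x == y) = true); [|by lia]
            | rewrite (_ : (x == y) = false); [|by lia]
            | case: (eqVneq x y) => ? ]
  | |- context [?x < ?y] =>
      first [ rewrite (_ : (x < y) = true); [|by lia]
            | rewrite (_ : (x < y) = false); [|by lia]
            | case: (ltrP x y) => ? ]
  end; rewrite /=).

Fixpoint step_parity (Q : rel site) (x : site) (s : seq site) : bool :=
  if s is y :: s' then Q x y (+) step_parity Q y s' else false.

Lemma step_parity_cat Q x s1 s2 :
  step_parity Q x (s1 ++ s2)
  = step_parity Q x s1 (+) step_parity Q (last x s1) s2.
Proof. by elim: s1 x => //= y s1 IH x; rewrite IH addbA. Qed.

Lemma step_parity_change (p : pred site) x s :
  step_parity (fun u v => p u (+) p v) x s = p x (+) p (last x s).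
Proof.
elim: s x => [|y s IH] x /=; first by rewrite addbb.
by rewrite IH addbA -(addbA (p x)) addbb addbF.
Qed.

Lemma eq_step_parity (Q1 Q2 : rel site) x s : path adj x s ->
  (forall u v, adj u v -> Q1 u v = Q2 u v) ->
  step_parity Q1 x s = step_parity Q2 x s.
Proof. by move=> + Q; elim: s x => //= y s IH x /andP[/Q -> /IH ->]. Qed.

Lemma step_parityD (Q1 Q2 : rel site) x s :
  step_parity (fun u v => Q1 u v (+) Q2 u v) x s
  = step_parity Q1 x s (+) step_parity Q2 x s.
Proof. by elim: s x => //= y s IH x; rewrite IH addbACA. Qed.

Lemma step_parity0 (Q : rel site) x s :
  {in x :: s &, forall u v, Q u v = false} -> step_parity Q x s = false.
Proof.
elim: s x => //= y s IH x Q0; rewrite Q0 ?IH // ?inE ?eqxx ?orbT //.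
by move=> u v us vs; apply: Q0; rewrite in_cons ?us ?vs orbT.
Qed.

Lemma adjP (u v : site) : adj u v ->
  [\/ v = (u.1 + 1, u.2), v = (u.1 - 1, u.2), v = (u.1, u.2 + 1)
    | v = (u.1, u.2 - 1)].
Proof.
case: u v => [u1 u2] [v1 v2]; rewrite /adj /= => uv.
have : ((v1 = u1 + 1 /\ v2 = u2) \/ (v1 = u1 - 1 /\ v2 = u2)) \/
  ((v1 = u1 /\ v2 = u2 + 1) \/ (v1 = u1 /\ v2 = u2 - 1)) by lia.
by move=> [[[-> ->]|[-> ->]]|[[-> ->]|[-> ->]]];
  [constructor 1|constructor 2|constructor 3|constructor 4].
Qed.

Lemma adjC (u v : site) : adj u v = adj v u.
Proof. by rewrite /adj distrC (distrC u.2). Qed.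

Definition same_edge (e : site * site) (u v : site) : bool :=
  ((u, v) == e) || ((v, u) == e).

(* The face [(i, j)] is the unit square with lower left corner [(i, j)]; its
   winding parity is that of the number of steps crossing the horizontal ray going from
   its centre to the right. *)
Definition crosses_ray (f u v : site) : bool :=
  [&& u.1 == v.1, f.1 < u.1 &
    (u.2 == f.2) && (v.2 == f.2 + 1) || (v.2 == f.2) && (u.2 == f.2 + 1)].

Definition winding (x : site) (s : seq site) (f : site) : bool :=
  step_parity (crosses_ray f) x s.

(** The rays of the two faces differ by exactly the edge that the faces share. *)
Lemma winding_left x s (i j : int) : path adj x s ->
  winding x s (i - 1, j) = winding x s (i, j)
    (+) step_parity (same_edge ((i, j), (i, j + 1))) x s.
Proof.
move=> xs; rewrite -step_parityD; apply: eq_step_parity => // -[u1 u2] [v1 v2].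
by rewrite /crosses_ray /same_edge => /adjP[] /= [-> ->]; rewrite !xpair_eqE;
  decide_atoms.
Qed.

(** Let [p] select the vertices of row [j] to the right of column [i]. The edges leaving this
    half-line are those crossing either ray and the edge shared by the two faces; a closed walk uses
    them an even number of times in all. *)
Lemma winding_down x s (i j : int) : path adj x s -> last x s = x ->
  winding x s (i, j - 1) = winding x s (i, j)
    (+) step_parity (same_edge ((i, j), (i + 1, j))) x s.
Proof.
move=> xs xx; pose p (u : site) := (u.2 == j) && (i < u.1).
rewrite -step_parityD -[LHS]addbF.
have <- : step_parity (fun u v => p u (+) p v) x s = false.
  by rewrite step_parity_change xx addbb.
rewrite -step_parityD; apply: eq_step_parity => // -[u1 u2] [v1 v2].
by rewrite /crosses_ray /same_edge /p => /adjP[] /= [-> ->];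
  rewrite !xpair_eqE; decide_atoms.
Qed.

(* The face lying at the start of the side [e], travelled with [e.1] on the
   left. *)
Definition start_face (e : site * site) : site :=
  let d := e.2 - e.1 in
  (if d.1 + d.2 < 0 then e.1.1 - 1 else e.1.1,
   if d.2 < d.1 then e.1.2 - 1 else e.1.2).

(** Whichever of its three forms the next side takes, it starts at the corner where [e] ends, and so
    does the image of [e] under a quarter turn around [e.1]. *)
Lemma start_face_next (A : set site) (e : site * site) : adj e.1 e.2 ->
  start_face (next_side A e) = start_face (e.1, e.1 + rot90 (e.2 - e.1)).
Proof.
case: e => a z /= az; case: ifP => // _.
case: ifP => _; rewrite /start_face /rot90 /=; move: az;
  case: a z => [a1 a2] [z1 z2] /adjP[] [-> ->] /=;
  congr pair; decide_atoms; lia.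
Qed.

Lemma same_edgeC a z x s :
  step_parity (same_edge (a, z)) x s = step_parity (same_edge (z, a)) x s.
Proof.
elim: s x => //= y s IH x; rewrite IH /same_edge !xpair_eqE.
by case: (x == a); case: (y == z); case: (y == a); case: (x == z).
Qed.

(** The two ends of a side are the faces separated by the edge from [e.1] to [e.2], so the parity
    changes with each passage of the walk along this edge. *)
Lemma winding_next A x s (e : site * site) :
  path adj x s -> last x s = x -> adj e.1 e.2 ->
  winding x s (start_face (next_side A e))
  = winding x s (start_face e) (+) step_parity (same_edge e) x s.
Proof.
move=> xs xx az; rewrite start_face_next //.
case: e az => -[a1 a2] [z1 z2] /adjP[] /= [-> ->].
- rewrite (_ : start_face _ = (a1, a2)); last first.
    by rewrite /start_face /rot90 /=; congr pair; decide_atoms; lia.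
  rewrite (_ : start_face _ = (a1, a2 - 1)); last first.
    by rewrite /start_face /=; congr pair; decide_atoms; lia.
  by rewrite winding_down // addbK.
- rewrite (_ : start_face _ = (a1 - 1, a2 - 1)); last first.
    by rewrite /start_face /rot90 /=; congr pair; decide_atoms; lia.
  rewrite (_ : start_face _ = (a1 - 1, a2)); last first.
    by rewrite /start_face /=; congr pair; decide_atoms; lia.
  by rewrite winding_down // subrK same_edgeC.
- rewrite (_ : start_face _ = (a1 - 1, a2)); last first.
    by rewrite /start_face /rot90 /=; congr pair; decide_atoms; lia.
  rewrite (_ : start_face _ = (a1, a2)); last first.
    by rewrite /start_face /=; congr pair; decide_atoms; lia.
  by rewrite winding_left.
- rewrite (_ : start_face _ = (a1, a2 - 1)); last first.
    by rewrite /start_face /rot90 /=; congr pair; decide_atoms; lia.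
  rewrite (_ : start_face _ = (a1 - 1, a2 - 1)); last first.
    by rewrite /start_face /=; congr pair; decide_atoms; lia.
  by rewrite winding_left // subrK same_edgeC addbK.
Qed.

Lemma same_edge_notin (a z : site) x s :
  a \notin x :: s -> step_parity (same_edge (a, z)) x s = false.
Proof.
move=> ax; apply: step_parity0 => u v us vs; rewrite /same_edge !xpair_eqE.
by case: eqP us ax => [-> ->|] //=; case: (v =P a) vs => [-> ->|] //=.
Qed.

(** The four faces around [a] have the same parity, as the walk uses no edge at [a]. On the right,
    [a] stands for the face whose lower left corner it is. *)
Lemma winding_corner x s (a z : site) :
  path adj x s -> last x s = x -> adj a z -> a \notin x :: s ->
  winding x s (start_face (a, z)) = winding x s a.
Proof.
move=> xs xx + ax; case: a z ax => [a1 a2] [z1 z2] ax /adjP[] /= [-> ->].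
- rewrite (_ : start_face _ = (a1, a2 - 1)); last first.
    by rewrite /start_face /=; congr pair; decide_atoms; lia.
  by rewrite winding_down // same_edge_notin // addbF.
- rewrite (_ : start_face _ = (a1 - 1, a2)); last first.
    by rewrite /start_face /=; congr pair; decide_atoms; lia.
  by rewrite winding_left // same_edge_notin // addbF.
- rewrite (_ : start_face _ = (a1, a2)) //.
  by rewrite /start_face /=; congr pair; decide_atoms; lia.
- rewrite (_ : start_face _ = (a1 - 1, a2 - 1)); last first.
    by rewrite /start_face /=; congr pair; decide_atoms; lia.
  rewrite winding_left // subrK same_edgeC same_edge_notin // addbF.
  by rewrite winding_down // same_edge_notin // addbF.
Qed.

Lemma winding_adj x s (u v : site) : path adj x s -> last x s = x ->
  adj u v -> u \notin x :: s -> v \notin x :: s ->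
  winding x s u = winding x s v.
Proof.
move=> xs xx + + +; case: u v => [u1 u2] [v1 v2] /adjP[] /= [-> ->] ux vx.
- rewrite -{1}(addrK 1 u1).
  by rewrite winding_left // same_edge_notin // addbF.
- by rewrite winding_left // same_edge_notin // addbF.
- rewrite -{1}(addrK 1 u2).
  by rewrite winding_down // same_edge_notin // addbF.
- by rewrite winding_down // same_edge_notin // addbF.
Qed.

Lemma winding_path x s u p : path adj x s -> last x s = x ->
  path adj u p -> {in u :: p, forall v, v \notin x :: s} ->
  winding x s u = winding x s (last u p).
Proof.
move=> xs xx; elim: p u => //= v p IH u /andP[uv vp] up.
rewrite (@winding_adj x s u v) ?up ?inE ?eqxx ?orbT //.
by apply: IH => // w wp; rewrite up // in_cons wp orbT.
Qed.

Lemma next_side_boundary (A : set site) (e : site * site) :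
  boundary_side A e -> boundary_side A (next_side A e).
Proof.
case: e => a z [/= Aa Az az].
have rotD (v w : site) : adj v (v + rot90 (w - v)) = adj v w.
  by case: v w => [v1 v2] [w1 w2]; rewrite /adj /rot90 /=; lia.
have rotE (v : site) : adj (v + rot90 (z - a)) v = adj a z.
  case: a z v {Aa Az az} => [a1 a2] [z1 z2] [v1 v2].
  by rewrite /adj /rot90 /=; lia.
have rotS : adj (a + rot90 (z - a)) (z + rot90 (z - a)) = adj a z.
  case: a z {Aa Az az rotE} => [a1 a2] [z1 z2].
  by rewrite /adj /rot90 /=; lia.
case: ifPn => [|/negPn]; rewrite ?notin_setE ?in_setE => a'.
  by split => //=; rewrite rotD.
case: ifPn => [|/negPn]; rewrite ?notin_setE ?in_setE => z'.
  by split => //=; rewrite rotS.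
by split => //=; rewrite rotE.
Qed.

(** Parities are read at the starts of the sides, so the last side is not itself travelled: hence
    [belast]. *)
Lemma winding_fpath A x s e q : path adj x s -> last x s = x ->
  boundary_side A e -> fpath (next_side A) e q ->
  {in belast e q, forall e',
    boundary_side A e' -> step_parity (same_edge e') x s = false} ->
  boundary_side A (last e q) /\
  winding x s (start_face (last e q)) = winding x s (start_face e).
Proof.
move=> xs xx; elim: q e => //= e' q IH e be /andP[/eqP <- eq] q0.
have [] := IH _ (next_side_boundary be) eq.
  by move=> f fq; apply: q0; rewrite in_cons fq orbT.
move=> bl ->; split => //; rewrite winding_next //; last by case: be.
by rewrite q0 ?mem_head // addbF.
Qed.

Definition linked (X : set site) (u v : site) : Prop :=
  X u /\ exists s, [/\ path adj u s, last u s = v & forall w, w \in s -> X w].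

Lemma linkedC X u v : linked X u v -> linked X v u.
Proof.
move=> [Xu [s [us <- Xs]]]; split.
  by case/lastP: s us Xs => // s w _; rewrite last_rcons; apply;
    rewrite mem_rcons mem_head.
exists (rev (belast u s)); split.
- by rewrite rev_path; under eq_path => ? ? do rewrite adjC.
- by case: (s) => // y s' /=; rewrite rev_cons last_rcons.
- move=> w; rewrite mem_rev => /mem_belast; rewrite in_cons => /predU1P[->//|].
  exact: Xs.
Qed.

Lemma subseq_cons_split (T : eqType) (x : T) (l s : seq T) :
  subseq (x :: l) s -> exists s1 s2, s = s1 ++ x :: s2 /\ subseq l s2.
Proof.
elim: s => //= y s IH; case: eqP => [->|_].
  by move=> ls; exists [::], s.
by move=> /IH[s1 [s2 [-> ?]]]; exists (y :: s1), s2.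
Qed.

Lemma boundary_crossing (A X Y : set site) (f1 f2 f3 f4 : site * site)
    (s : seq (site * site)) :
  graph_connected (~` A) -> X `<=` A -> Y `<=` A ->
  boundary_side A f1 -> boundary_side A f2 -> boundary_side A f3 ->
  sorted (frel (next_side A)) s -> uniq s ->
  subseq [:: f1; f2; f3; f4] s ->
  linked X f1.1 f3.1 -> linked Y f2.1 f4.1 -> exists v, X v /\ Y v.
Proof.
move=> hC XA YA bf1 bf2 bf3 hs us /subseq_cons_split[s1 [t1 [sE]]].
move=> /subseq_cons_split[s2 [t2 [t1E /subseq_cons_split[s3 [t3 [t2E]]]]]].
move=> /subseq_cons_split[s4 [s5 [t3E _]]]; subst s t1 t2 t3.
move=> [Xb1 [p [b1p pb3 Xp]]] [Yb2 [r [b2r rb4 Yr]]].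
apply: contrapT => nXY.
case: (bf1) (bf3) => Ab1 Az1 a1 [Ab3 Az3 a3].
(* The closed walk [C] enters [A] through [f1], follows [p] in [X], leaves through [f3] and returns
   by [q] in the complement. *)
have [q [z3q qz1 Aq]] := hC _ _ Az3 Az1.
pose C := f1.1 :: p ++ f3.2 :: q.
have CP : path adj f1.2 C by rewrite /= adjC a1 cat_path b1p /= pb3 a3.
have CL : last f1.2 C = f1.2 by rewrite /= last_cat.
have Xbp w : w \in f1.1 :: p -> X w by rewrite in_cons => /predU1P[->|/Xp].
have Cq w : w \in f3.2 :: q -> ~ A w by rewrite in_cons => /predU1P[->|/Aq].
have edgeE e z b : boundary_side A e -> A b -> ~ A z ->
    same_edge e z b = (e == (b, z)).
  move=> [Ae1 _ _] Ab Az; rewrite /same_edge [_ == e]eq_sym orbC eq_sym.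
  by case: ((e) =P (z, b)) Ae1 => [->|]; rewrite ?orbF.
(* As [p] stays in [A] and [q] outside, [C] passes between [A] and its complement only at [f1] and
   at [f3]. *)
have parC e : boundary_side A e ->
    step_parity (same_edge e) f1.2 C = (e == f1) (+) (e == f3).
  move=> be; rewrite /C [step_parity _ _ _]/= step_parity_cat /= pb3.
  rewrite edgeE // -surjective_pairing.
  have -> : same_edge e f3.1 f3.2 = (e == f3).
    rewrite /same_edge orbC -/(same_edge e f3.2 f3.1).
    by rewrite edgeE // -surjective_pairing.
  rewrite [step_parity _ f1.1 p]step_parity0 => [|u v /Xbp/XA Au /Xbp/XA Av].
    rewrite [step_parity _ _ q]step_parity0 ?addbF // => u v /Cq Au /Cq Av.
    by case: be => Ae _ _; rewrite /same_edge; apply/negbTE;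
      rewrite negb_or; apply/andP; split; apply/eqP => ee; rewrite -ee in Ae.
  by case: be => _ Ae _; rewrite /same_edge; apply/negbTE;
    rewrite negb_or; apply/andP; split; apply/eqP => ee; rewrite -ee in Ae.
have notC v : Y v -> v \notin f1.2 :: C.
  move=> Yv; rewrite /C !in_cons mem_cat orbA; apply/negP.
  move=> /orP[/orP[/eqP vz|/eqP vb]|/orP[vp|/Cq]].
  - by apply: Az1; rewrite -vz; exact: YA.
  - by apply: nXY; exists v; rewrite {1}vb.
  - by apply: nXY; exists v; split=> //; exact: Xp.
  - by apply; exact: YA.
have Wb : winding f1.2 C f2.1 = winding f1.2 C f4.1.
  rewrite -rb4; apply: winding_path => // v.
  by rewrite in_cons => /predU1P[->|/Yr]; exact: notC.
(* As [s] has no repetition, the stretch from [f2] to [f4] avoids [f1] and meets [f3] once. *)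
have [f1n f3n] : f1 \notin f2 :: s3 ++ f3 :: s4 /\ f3 \notin f2 :: s3 ++ s4.
  move: us; rewrite cat_uniq => /and3P[_ _]; rewrite cons_uniq => /andP[f1n].
  rewrite cat_uniq => /and3P[_ _]; rewrite cons_uniq => /andP[f2n].
  rewrite cat_uniq => /and3P[_ f3n]; rewrite cons_uniq => /andP[f3m _].
  move: f1n f2n f3n f3m.
  rewrite /= !(mem_cat, in_cons) !negb_or (eq_sym f3 f2).
  move=> /and5P[_ -> -> -> /andP[-> _]] /and3P[_ -> _] /andP[-> _].
  by move=> /andP[-> _].
have {hs} : sorted (frel (next_side A))
    ((s1 ++ f1 :: s2) ++ f2 :: s3 ++ f3 :: s4 ++ f4 :: s5) by rewrite -catA.
move=> /cat_sorted2[_ /=]; rewrite -cat_rcons cat_path last_rcons.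
rewrite -cat_rcons cat_path => /and3P[P3 P4 _].
have [|_] := winding_fpath CP CL bf2 P3.
  move=> e; rewrite belast_rcons => e3 be; rewrite parC //.
  have -> : (e == f1) = false.
    by apply: contraNF f1n => /eqP <-; rewrite -cat_cons mem_cat e3.
  by apply: contraNF f3n => /eqP <-; rewrite -cat_cons mem_cat e3.
rewrite last_rcons => W3.
(* The passage along [f3] is set apart, being the only one that flips the parity. *)
case E4: (rcons s4 f4) P4 => [|h t]; first by case: (s4) E4.
move=> /= /andP[/eqP nf3 P4].
have [s4E f4E] : (s4, f4) = (belast h t, last h t).
  by apply: rcons_inj; rewrite E4 lastI.
have [||] := winding_fpath CP CL _ P4.
- by rewrite -nf3; exact: next_side_boundary.
- move=> e; rewrite -s4E => e4 be; rewrite parC //.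
  have -> : (e == f1) = false.
    by apply: contraNF f1n => /eqP <-; rewrite in_cons mem_cat in_cons e4 !orbT.
  by apply: contraNF f3n => /eqP <-; rewrite in_cons mem_cat e4 !orbT.
rewrite -f4E -nf3 => bf4; rewrite winding_next //.
rewrite parC // eqxx (_ : (f3 == f1) = false); last first.
  by apply: contraNF f1n => /eqP <-; rewrite -cat_cons mem_cat mem_head orbT.
rewrite W3.
(* The parities at the starts of [f2] and [f4] are those at [f2.1] and [f4.1], which [Wb] equates; a
   single flip at [f3] is then impossible. *)
have Wf f : boundary_side A f -> Y f.1 ->
    winding f1.2 C (start_face f) = winding f1.2 C f.1.
  case: f => a z [_ _ az] Ya; apply: winding_corner => //; exact: notC.
rewrite !Wf // -?Wb; first by case: winding.
by case: (linkedC (conj Yb2 (ex_intro _ r (And3 b2r rb4 Yr)))).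
Qed.

(** Rotating the four sides preserves the two pairs of opposite sides. Odd rotations exchange the
    roles of [X] and [Y], and a rotation by 4 or more changes nothing. *)
Lemma ccw_crossing (A X Y : set site) (e1 e2 e3 e4 : site * site) :
  graph_connected (~` A) -> X `<=` A -> Y `<=` A ->
  boundary_side A e1 -> boundary_side A e2 ->
  boundary_side A e3 -> boundary_side A e4 -> ccw_sides A e1 e2 e3 e4 ->
  linked X e1.1 e3.1 -> linked Y e2.1 e4.1 -> exists v, X v /\ Y v.
Proof.
move=> hC XA YA b1 b2 b3 b4 [s [n [hs us]]] sub LX LY.
have sw : (exists v, Y v /\ X v) -> exists v, X v /\ Y v.
  by move=> [v [? ?]]; exists v.
have [n4|n4] := leqP 4 n.
  move: sub; rewrite rot_oversize // => sub.
  exact: (@boundary_crossing A X Y e1 e2 e3 e4 s).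
case: n n4 sub => [|[|[|[|//]]]] _ sub.
- exact: (@boundary_crossing A X Y e1 e2 e3 e4 s).
- apply: sw; apply: (@boundary_crossing A Y X e2 e3 e4 e1 s) => //.
  exact: linkedC.
- by apply: (@boundary_crossing A X Y e3 e4 e1 e2 s) => //; exact: linkedC.
- apply: sw; apply: (@boundary_crossing A Y X e4 e1 e2 e3 s) => //.
  exact: linkedC.
Qed.

(** * Exchange of tails *)

(** The excursion never returns to [x], so its erasure keeps the first step, into [A]. It still ends
    at [y] and visits [y] only once, so all its inner sites are in [A]. *)
Lemma excursion_loop_erasure (A : set site) (x y : site) (w : seq site) :
  x != y -> excursions A x y w -> excursions A x y (loop_erasure w).
Proof.
move=> xy [bx yb [s [wE s0 sA ws]]]; split=> //.
have xs : x \notin rcons s y.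
  rewrite mem_rcons in_cons negb_or xy; apply/negP => /sA.
  by case: bx.
have := erases_loop_erasure w; rewrite {1}wE => /(erases_cons_inv xs)[l -> sl].
have hl := erases_head x sl; have ul := erases_uniq_out sl.
have := @erases_path _ adj x _ _ sl; rewrite wE in ws.
move=> /(_ ws)[xl]; rewrite last_rcons => ly.
have sub := erases_sub sl.
case/lastP: l sl hl ul xl ly sub => [|t z] sl hl ul xl ly sub.
  by move: xy; rewrite -ly eqxx.
rewrite last_rcons in ly; subst z.
exists t; split=> //.
- move=> t0; move: hl; rewrite t0; case: (s) s0 sA => //= a s' _ sA ya.
  by case: yb => + _; apply; rewrite ya; apply: sA; rewrite mem_head.
- move=> v vt; have := sub v; rewrite !mem_rcons !in_cons vt orbT => /(_ isT).
  case/predU1P => [vy|/sA //].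
  by move: ul; rewrite rcons_uniq -vy vt.
Qed.

Lemma excursion_linked (A : set site) (x y : site) (w : seq site) :
  excursions A x y w -> exists b c, [/\ boundary_side A (b, x),
    boundary_side A (c, y) & linked [set v | v \in w /\ A v] b c].
Proof.
move=> [[Ax _] [Ay _] [[|b s] [-> // _ sA /=]]]; rewrite rcons_path.
move=> /and3P[xb bs cy]; have Ab := sA b (mem_head _ _).
have Ac := sA (last b s) (mem_last _ _).
exists b, (last b s); split; rewrite ?/boundary_side ?(adjC b) //.
split; first by rewrite /= !in_cons eqxx orbT.
exists s; split=> // v vs; split; last by apply: sA; rewrite in_cons vs orbT.
by rewrite !in_cons mem_rcons in_cons vs !orbT.
Qed.

(** The endpoints of the two excursions alternate around the boundary, and the sites of [A] that
    they visit serve as the two connected sets. *)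
Lemma excursions_cross (A : set site) (x1 x2 y1 y2 : site) (w1 w2 : seq site) :
  graph_connected (~` A) -> ccw A x1 x2 y2 y1 ->
  excursions A x1 y2 w1 -> excursions A x2 y1 w2 ->
  exists2 v, v \in w1 & v \in w2.
Proof.
move=> hC hccw /excursion_linked[a1 [a3 [s1 s3 L1]]].
move=> /excursion_linked[a2 [a4 [s2 s4 L2]]].
have [| |v [[vw1 _] [vw2 _]]] := ccw_crossing hC _ _ s1 s2 s3 s4
  (hccw _ _ _ _ s1 s2 s3 s4) L1 L2; [by move=> v []|by move=> v []|].
by exists v.
Qed.

(** The first occurrence of [v] in the reversed walk is its last visit; [upto] ends with it and
    [after] begins just beyond it. *)
Definition upto (T : eqType) (v : T) (w : seq T) :=
  rev (drop (index v (rev w)) (rev w)).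

Definition after (T : eqType) (v : T) (w : seq T) :=
  rev (take (index v (rev w)) (rev w)).

Lemma index_rev_split (T : eqType) (v : T) (a b : seq T) :
  v \notin b -> index v (rev (a ++ v :: b)) = size (rev b).
Proof.
move=> vb; rewrite rev_cat rev_cons cat_rcons index_cat mem_rev (negbTE vb) /=.
by rewrite eqxx addn0.
Qed.

Lemma upto_split (T : eqType) (v : T) (a b : seq T) :
  v \notin b -> upto v (a ++ v :: b) = rcons a v.
Proof.
move=> vb; rewrite /upto index_rev_split // rev_cat rev_cons cat_rcons.
by rewrite drop_size_cat // rev_cons revK.
Qed.

Lemma after_split (T : eqType) (v : T) (a b : seq T) :
  v \notin b -> after v (a ++ v :: b) = b.
Proof.
move=> vb; rewrite /after index_rev_split // rev_cat rev_cons cat_rcons.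
by rewrite take_size_cat // revK.
Qed.

Definition meets (w : seq site * seq site) : bool :=
  has (mem w.2) (loop_erasure w.1).

(* Fomin's involution: [v] is the first vertex of [l] lying on [w.2]. *)
Definition swap_tails (w : seq site * seq site) : seq site * seq site :=
  let l := loop_erasure w.1 in
  let v := nth (0, 0) l (find (mem w.2) l) in
  (upto v w.1 ++ after v w.2, upto v w.2 ++ after v w.1).

(* The conditions are symmetric in [b] and [d], the tails to be exchanged. *)
Definition fomin_split (w : seq site * seq site) l v a b c d : Prop :=
  [/\ w = (a ++ v :: b, c ++ v :: d), erases (rcons a v) (rcons l v),
      v \notin b, v \notin d & {in l, forall x, x \notin b ++ c ++ v :: d}].

Lemma fomin_split_sym w l v a b c d : fomin_split w l v a b c d ->
  fomin_split (a ++ v :: d, c ++ v :: b) l v a d c b.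
Proof.
move=> [_ al vb vd ln]; split=> // x /ln; apply: contra.
by rewrite !mem_cat !in_cons; do ![case: (_ \in _)|case: (_ == _)].
Qed.

(** Both walks are cut at their last visit of the first vertex [v] of the erasure lying on [w.2].
    The vertices [l] before [v] avoid [b] by the erasure, and [w.2] by the choice of [v]. *)
Lemma meets_split w : meets w ->
  exists l v a b c d, fomin_split w l v a b c d.
Proof.
case: w => w1 w2; rewrite /meets /= => hw.
have := erases_loop_erasure w1.
case/split_find: hw => v l m vw2 lw2; rewrite cat_rcons.
move=> /erases_split[a [b [-> al vb lb _]]].
have vr : v \in rev w2 by rewrite mem_rev.
have := congr1 rev (cat_take_drop (index v (rev w2)) (rev w2)).
rewrite revK (drop_index vr) rev_cat rev_cons cat_rcons.
set c := rev (drop _ _); set d := rev (take _ _) => w2E.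
exists l, v, a, b, c, d; split=> //; first by rewrite w2E.
  by rewrite mem_rev in_take_leq ?index_size // ltnn.
move=> x xl; rewrite mem_cat w2E negb_or lb //.
by apply: contra lw2 => xw; apply/hasP; exists x.
Qed.

(** The erasure up to [v] depends on [a] alone, and [l] avoids [c] and both tails, so the same [v]
    is found before and after the exchange. This is why the exchange undoes itself. *)
Lemma fomin_splitP w l v a b c d : fomin_split w l v a b c d ->
  meets w /\ swap_tails w = (a ++ v :: d, c ++ v :: b).
Proof.
move=> [-> al vb vd ln]; rewrite /meets /swap_tails /=.
have lE : loop_erasure (a ++ v :: b) = l ++ v :: loop_erasure b.
  apply: erases_fun (erases_loop_erasure _) _.
  rewrite -!cat_rcons; apply: erases_cat => //; last exact: erases_loop_erasure.
  move=> x; rewrite mem_rcons in_cons => /predU1P[->//|/ln].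
  by rewrite mem_cat negb_or => /andP[].
have hl : has (mem (c ++ v :: d)) l = false.
  apply/negbTE/hasPn => x /ln; rewrite mem_cat negb_or => /andP[_].
  by [].
rewrite lE has_cat hl /= mem_cat mem_head orbT; split=> //.
rewrite find_cat hl /= mem_cat mem_head orbT addn0 nth_cat ltnn subnn /=.
by rewrite !upto_split // !after_split // !cat_rcons.
Qed.

Lemma swap_tailsK w : meets w ->
  meets (swap_tails w) /\ swap_tails (swap_tails w) = w.
Proof.
move=> /meets_split[l [v [a [b [c [d sp]]]]]].
have [_ ->] := fomin_splitP sp.
have [-> ->] := fomin_splitP (fomin_split_sym sp).
by case: sp.
Qed.

Lemma excursion_cutP (A : set site) x y a v b : A v ->
  excursions A x y (a ++ v :: b) <->
  [/\ boundary A x, boundary A y & exists a' b',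
     [/\ a = x :: a', b = rcons b' y, {in a' ++ b', forall u, A u},
         sorted adj (rcons a v) & path adj v b]].
Proof.
move=> Av; have cutE (s1 s2 : seq site) : sorted adj (s1 ++ v :: s2) =
    sorted adj (rcons s1 v) && path adj v s2.
  by case: s1 => [|z s1] //=; rewrite -cat_rcons cat_path last_rcons.
split=> [[bx yb [s [sE s0 sA]]]|[bx yb [a' [b' [-> -> abA av vb]]]]].
  rewrite cutE => /andP[av vb].
  split=> //; case: a sE av => [|x1 a] /= [] xE sE av.
    by case: bx => + _; rewrite -xE.
  case/lastP: b sE vb => [|b y1] sE vb.
    move: sE; rewrite cats1 => /rcons_inj[_ vy].
    by case: yb => + _; rewrite -vy.
  move: sE; rewrite -rcons_cons -rcons_cat => /rcons_inj[sE yE].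
  exists a, b; rewrite -xE -yE; split=> // u; rewrite mem_cat => uab.
  by apply: sA; rewrite -sE mem_cat in_cons; case/orP: uab => ->; rewrite ?orbT.
split=> //; exists (a' ++ v :: b'); split.
- by rewrite /= -rcons_cons -rcons_cat.
- by case: (a').
- move=> u; rewrite mem_cat in_cons orbCA => /predU1P[->//|uab].
  by apply: abA; rewrite mem_cat.
- by rewrite cutE av.
Qed.

Lemma excursion_swap (A : set site) x y x' y' a b c d v : A v ->
  excursions A x y (a ++ v :: b) -> excursions A x' y' (c ++ v :: d) ->
  excursions A x y' (a ++ v :: d).
Proof.
move=> Av /(excursion_cutP _ _ _ _ Av)[bx _ [a' [b' [-> _ abA av _]]]].
move=> /(excursion_cutP _ _ _ _ Av)[_ yb [c' [d' [_ -> cdA _ vd]]]].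
apply/(excursion_cutP _ _ _ _ Av); split=> //; exists a', d'; split=> // u.
rewrite mem_cat => /orP[ua|ud].
  by apply: abA; rewrite mem_cat ua.
by apply: cdA; rewrite mem_cat ud orbT.
Qed.

Lemma excursion_mem (A : set site) x y w v :
  excursions A x y w -> v \in w -> [\/ v = x, v = y | A v].
Proof.
move=> [_ _ [s [-> _ sA _]]]; rewrite in_cons mem_rcons in_cons.
by move=> /predU1P[->|/predU1P[->|/sA]];
  [constructor 1|constructor 2|constructor 3].
Qed.

Definition meeting_pairs (A : set site) (x1 y1 x2 y2 : site) :
    set (seq site * seq site) :=
  [set w | [/\ excursions A x1 y1 w.1, excursions A x2 y2 w.2 & meets w]].

Lemma swap_meeting_pairs (A : set site) x1 x2 y1 y2 w :
  uniq [:: x1; x2; y2; y1] -> meeting_pairs A x1 y1 x2 y2 w ->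
  meeting_pairs A x1 y2 x2 y1 (swap_tails w).
Proof.
move=> dis [+ + mw].
have [l [v [a [b [c [d sp]]]]]] := meets_split mw.
have [_ ->] := fomin_splitP sp.
have [ms _] := fomin_splitP (fomin_split_sym sp).
case: sp => -> _ _ _ _ /= e1 e2.
(* The four endpoints are distinct, so a site common to both excursions lies in [A]. *)
have Av : A v.
  have := excursion_mem e2; have := excursion_mem e1.
  move=> /(_ v) + /(_ v); rewrite !mem_cat !mem_head !orbT.
  move=> /(_ isT) v1 /(_ isT) v2.
  case: v1 v2 => [->|->|//]; case=> // vE; move: dis;
    rewrite -vE /= !inE !eqxx ?orbT ?andbF //.
split=> //; [exact: excursion_swap e1 e2|exact: excursion_swap e2 e1].
Qed.

Lemma swap_tails_bij (A : set site) x1 x2 y1 y2 : uniq [:: x1; x2; y2; y1] ->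
  set_bij (meeting_pairs A x1 y1 x2 y2) (meeting_pairs A x1 y2 x2 y1)
    swap_tails.
Proof.
move=> dis; have dis' : uniq [:: x1; x2; y1; y2].
  by move: dis; rewrite /= !inE (eq_sym y2 y1); do 6 case: (_ == _).
split=> [w|w w'|w].
- exact: swap_meeting_pairs.
- rewrite !inE => -[_ _ mw] [_ _ mw'] sE.
  by rewrite -(swap_tailsK mw).2 sE (swap_tailsK mw').2.
- move=> ww; exists (swap_tails w); first exact: swap_meeting_pairs.
  by case: ww => _ _ /swap_tailsK[].
Qed.

(** The loop erasure of an excursion is an excursion with the same endpoints, so planarity applies
    to the erasure itself. *)
Lemma crossing_pairs_meet (A : set site) x1 x2 y1 y2 :
  graph_connected (~` A) -> ccw A x1 x2 y2 y1 -> x1 != y2 ->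
  meeting_pairs A x1 y2 x2 y1 = excursions A x1 y2 `*` excursions A x2 y1.
Proof.
move=> hC hccw xy; apply/seteqP; split=> [w []//|w [/= e1 e2]]; split=> //.
have [v vl vw] := excursions_cross hC hccw (excursion_loop_erasure xy e1) e2.
by apply/hasP; exists v.
Qed.

Lemma walk_weight_swap (R : realType) w : meets w ->
  walk_weight R (swap_tails w).1 * walk_weight R (swap_tails w).2
  = walk_weight R w.1 * walk_weight R w.2.
Proof.
move=> /meets_split[l [v [a [b [c [d sp]]]]]]; have [_ ->] := fomin_splitP sp.
case: sp => -> _ _ _ _; rewrite /walk_weight /= -!invfM -!exprD.
by congr (_ ^- _); rewrite !size_cat /= !addnS /=; lia.
Qed.

Lemma excursions_nonempty (A : set site) x y : graph_connected A ->
  boundary A x -> boundary A y -> excursions A x y !=set0.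
Proof.
move=> cA bx yb; case: (bx) (yb) => [_ [b Ab xb]] [_ [c Ac yc]].
have [s [bs sc sA]] := cA _ _ Ab Ac.
exists (x :: rcons (b :: s) y); split=> //; exists (b :: s); split=> //.
  by move=> v; rewrite in_cons => /predU1P[->|/sA].
by rewrite /= xb rcons_path bs sc /= adjC.
Qed.

(** * Probabilities *)

Local Open Scope ereal_scope.

Lemma esumZl (R : realType) (T : choiceType) (D : set T) (k : R)
    (a : T -> \bar R) : (0 < k)%R -> (forall i, 0 <= a i) ->
  \esum_(i in D) (k%:E * a i) = k%:E * \esum_(i in D) a i.
Proof.
(* One inequality suffices: applied to the inverse of [k] and the terms [k%:E * a i], it gives the
   other. *)
have le_mul (c : R) (b : T -> \bar R) : (0 < c)%R -> (forall i, 0 <= b i) ->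
    \esum_(i in D) (c%:E * b i) <= c%:E * \esum_(i in D) b i.
  move=> c0 b0; apply: ge_ereal_sup => _ [X [finX XD] <-].
  rewrite -ge0_mule_fsumr // lee_pmul2l // ?lte_fin //.
  by apply: ereal_sup_ubound; exists X.
move=> k0 a0; apply/eqP; rewrite eq_le le_mul //=.
rewrite -lee_pdivlMl //.
rewrite -[leLHS](@eq_esum _ _ _ (fun i => (k^-1)%:E * (k%:E * a i))).
  by apply: le_mul => [|i]; rewrite ?invr_gt0 // mule_ge0 // lee_fin ltW.
by move=> i _; rewrite muleA -EFinM mulVf ?gt_eqF // mul1e.
Qed.

(** Both factors are positive, since the terms are and the index sets are non-empty; a finite
    product then forces both to be finite, and [fine] loses nothing. *)
Lemma esum_prod_fine (R : realType) (T1 T2 : choiceType) (D1 : set T1)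
    (D2 : set T2) (f : T1 -> R) (g : T2 -> R) :
  (forall i, 0 < f i)%R -> (forall j, 0 < g j)%R -> D1 !=set0 -> D2 !=set0 ->
  \esum_(k in D1 `*` D2) (f k.1 * g k.2)%:E < +oo ->
  \esum_(k in D1 `*` D2) (f k.1 * g k.2)%:E
  = (fine (\esum_(i in D1) (f i)%:E) * fine (\esum_(j in D2) (g j)%:E))%:E.
Proof.
move=> f0 g0 [i Di] [j Dj].
have fE0 i' : 0 <= (f i')%:E by rewrite lee_fin ltW.
have gE0 j' : 0 <= (g j')%:E by rewrite lee_fin ltW.
have le_term (T : choiceType) (D : set T) (a : T -> \bar R) (k : T) :
    (forall k, 0 <= a k) -> D k -> a k <= \esum_(i in D) a i.
  move=> a0 Dk; apply: esum_ge; exists [set k]; last by rewrite fsbig_set1.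
  by split=> // _ ->.
have -> : \esum_(k in D1 `*` D2) (f k.1 * g k.2)%:E
    = \esum_(i in D1) ((f i)%:E * \esum_(j in D2) (g j)%:E).
  rewrite -(@esum_esum _ _ _ D1 (fun=> D2)
    (fun i j => (f i * g j)%:E)); last first.
    by move=> i' j' _ _; rewrite EFinM mule_ge0.
  by apply: eq_esum => i' _; rewrite -esumZl //.
set G := \esum_(j in D2) _.
have Gj : (g j)%:E <= G by exact: le_term.
have G0 : 0 < G by apply: lt_le_trans Gj; rewrite lte_fin.
move=> fin; have : (f i)%:E * G < +oo.
  apply: le_lt_trans fin.
  by apply: (le_term _ _ (fun i => (f i)%:E * G)) => // k;
    rewrite mule_ge0 // ltW.
case: G G0 fin {Gj} => [r| |]//; last by rewrite gt0_muley // lte_fin.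
rewrite lte_fin => r0; under eq_esum do rewrite muleC.
rewrite esumZl // => + _; set F := \esum_(i in D1) _.
have : 0 <= F by exact: esum_ge0.
case: F => [s| |] //; first by rewrite -EFinM /= mulrC.
by rewrite gt0_muley ?lte_fin.
Qed.

Lemma measure_countable_bigcup d (T : measurableType d) (R : realType)
    (mu : {measure set T -> \bar R}) (I : countType) (D : set I)
    (F : I -> set T) : (forall i, measurable (F i)) -> trivIset D F ->
  measurable (\bigcup_(i in D) F i) /\
  mu (\bigcup_(i in D) F i) = \esum_(i in D) mu (F i).
Proof.
move=> mF tF; pose F' n := if pickle_inv n is Some i then F i else set0.
have FE i : F' (pickle i) = F i by rewrite /F' pickleK_inv.
have mF' n : measurable (F' n) by rewrite /F'; case: pickle_inv.
have -> : \bigcup_(i in D) F i = \bigcup_(n in pickle @` D) F' n.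
  by rewrite bigcup_image; apply: eq_bigcupr => i _; rewrite FE.
split; first exact: bigcup_measurable.
rewrite measure_bigcup //; last first.
  by move=> _ _ [i Di <-] [j Dj <-]; rewrite !FE => /(tF _ _ Di Dj) ->.
rewrite nneseries_esum // set_mem_set esum_image; last first.
  by move=> i j _ _; exact: (pcan_inj pickleK).
by apply: eq_esum => i _; rewrite FE.
Qed.

Lemma walk_weight_gt0 (R : realType) w : (0 < walk_weight R w)%R.
Proof. by rewrite /walk_weight invr_gt0 exprn_gt0. Qed.

(** Were the kernel 0, every excursion would have probability 0, as division by 0 gives 0, against a
    total mass of 1. Since [fine] sends [+oo] to 0, this also shows that the sum is finite. *)
Lemma excursion_kernel_gt0 d (T : measurableType d) (R : realType)
    (P : probability T R) (A : set site) (x y : site) (S : T -> seq site) :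
  rw_excursion P A x y S -> (0 < excursion_kernel R A x y)%R.
Proof.
move=> [Sexc mS PS]; rewrite lt_def; apply/andP; split; last first.
  by apply/fine_ge0/esum_ge0 => w _; rewrite lee_fin ltW ?walk_weight_gt0.
apply/eqP => h0; have := @probability_setT _ _ _ P.
have -> : setT = \bigcup_(w in excursions A x y) S @^-1` [set w].
  by apply/esym; rewrite -subTset => t _; exists (S t).
rewrite (measure_countable_bigcup P mS _).2.
  rewrite esum1 => [/eqP|w exw]; first by rewrite eq_sym onee_eq0.
  by move: (PS _ exw); rewrite h0 invr0 mulr0.
by move=> w w' _ _ [t [/= -> ->]].
Qed.

(** The event splits into countably many disjoint events, one for each meeting pair, whose
    probabilities factor by independence. *)
Lemma probability_meets d (T : measurableType d) (R : realType)
    (P : probability T R) (A : set site) (x1 x2 y1 y2 : site)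
    (S1 S2 : T -> seq site) :
  rw_excursion P A x1 y1 S1 -> rw_excursion P A x2 y2 S2 ->
  independent_paths P S1 S2 ->
  let M := [set t | meets (S1 t, S2 t)] in
  measurable M /\
  P M = ((excursion_kernel R A x1 y1 * excursion_kernel R A x2 y2)^-1)%:E *
    \esum_(w in meeting_pairs A x1 y1 x2 y2)
      (walk_weight R w.1 * walk_weight R w.2)%:E.
Proof.
move=> hS1 hS2 ind M.
have h1 := excursion_kernel_gt0 hS1; have h2 := excursion_kernel_gt0 hS2.
case: hS1 hS2 => S1e mS1 PS1 [S2e mS2 PS2].
pose F (w : seq site * seq site) := S1 @^-1` [set w.1] `&` S2 @^-1` [set w.2].
have -> : M = \bigcup_(w in meeting_pairs A x1 y1 x2 y2) F w.
  apply/seteqP; split=> [t Mt|t [[w1 w2] [/= _ _ m] [/= E1 E2]]].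
    by exists (S1 t, S2 t); split=> //=.
  by rewrite /M /= E1 E2.
have [|mU ->] := @measure_countable_bigcup _ _ _ P _
    (meeting_pairs A x1 y1 x2 y2) F (fun w => measurableI _ _ (mS1 _) (mS2 _)).
  by move=> [u1 u2] [v1 v2] _ _ [t [[/= <- <-] [/= <- <-]]].
split=> //; rewrite -esumZl ?invr_gt0 ?mulr_gt0 //; last first.
  by move=> w; rewrite lee_fin mulr_ge0 // ltW ?walk_weight_gt0.
apply: eq_esum => w [e1 e2 _]; apply: eq_trans (ind [set w.1] [set w.2]) _.
by rewrite PS1 // PS2 // -!EFinM invfM mulrACA mulrC.
Qed.

Local Close Scope ereal_scope.

Theorem theorem3p2 (R : realType) (d : measure_display) (T : measurableType d)
    (P : probability T R) (A : set site) (x1 x2 y1 y2 : site)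
    (S1 S2 : T -> seq site)
    (hA : simply_connected A) (h0 : A (0, 0))
    (hx1 : boundary A x1) (hx2 : boundary A x2)
    (hy1 : boundary A y1) (hy2 : boundary A y2)
    (hdistinct : uniq [:: x1; x2; y2; y1])
    (hccw : ccw A x1 x2 y2 y1)
    (hS1 : rw_excursion P A x1 y1 S1) (hS2 : rw_excursion P A x2 y2 S2)
    (hindep : independent_paths P S1 S2) :
  P [set t | [set` loop_erasure (S1 t)] `&` [set` S2 t] = set0] =
  (\det (\matrix_(i < 2, j < 2)
           excursion_kernel R A (if i == 0 then x1 else x2)
                                (if j == 0 then y1 else y2))
   / (excursion_kernel R A x1 y1 * excursion_kernel R A x2 y2))%:E.
Proof.
have [mM PM] := probability_meets hS1 hS2 hindep.
set M := [set t | _] in mM PM.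
have -> : [set t | [set` loop_erasure (S1 t)] `&` [set` S2 t] = set0] = ~` M.
  apply/seteqP; split=> t /=.
    by move=> + /hasP[v vl vS]; rewrite -subset0 => /(_ v); apply.
  move=> nM; rewrite -subset0 => v [vl vS]; apply: nM.
  by apply/hasP; exists v.
have h1 := excursion_kernel_gt0 hS1; have h2 := excursion_kernel_gt0 hS2.
have k0 : 0 < (excursion_kernel R A x1 y1 * excursion_kernel R A x2 y2)^-1.
  by rewrite invr_gt0 mulr_gt0.
have x1y2 : x1 != y2.
  by move: hdistinct; rewrite /= !inE !negb_or => /andP[/and3P[]].
case: hA => _ _ cA cC.
have w0 := @walk_weight_gt0 R.
(* The exchange of tails carries the meeting pairs onto those with crossed endpoints, which by
   planarity are all pairs with these endpoints. *)
have swapE : (\esum_(w in meeting_pairs A x1 y1 x2 y2)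
      (walk_weight R w.1 * walk_weight R w.2)%:E =
    \esum_(w in excursions A x1 y2 `*` excursions A x2 y1)
      (walk_weight R w.1 * walk_weight R w.2)%:E)%E.
  rewrite -(crossing_pairs_meet cC hccw x1y2).
  rewrite (@reindex_esum _ _ _ _ _ _ _ (swap_tails_bij A hdistinct)).
  by apply: eq_esum => w [_ _ mw]; rewrite walk_weight_swap.
rewrite probability_setC // PM swapE esum_prod_fine //; first last.
(* An infinite sum would make the probability of [M] infinite. This yields the finiteness of the
   crossed kernels, for which no random excursion is given. *)
- have PM1 : (P M <= 1)%E by exact: probability_le1.
  rewrite -swapE; case: (esum _ _) PM PM1 => [r| |] // ->.
    by rewrite ltry.
  by rewrite gt0_muley ?lte_fin.
- exact: excursions_nonempty.
- exact: excursions_nonempty.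
rewrite -EFinM -EFinB; congr _%:E.
rewrite (expand_det_row _ 0) !big_ord_recl big_ord0 /= /cofactor.
rewrite !det_mx11 !mxE /=.
rewrite -/(excursion_kernel R A x1 y2) -/(excursion_kernel R A x2 y1).
rewrite (_ : (0 + bump 0 0)%N = 1%N) //.
by field; rewrite !gt_eqF.
Qed.
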